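(* There is a constant $c$ such that the following holds. Let $n\ge 1$ and let $f:\{0,1\}^n\times\{0,1\}^n\to\{0,1\}$ satisfy $C(f\mid n)\ge 2^{2n}-n$, where $f$ is identified with its truth table (a binary string of length $2^{2n}$). Then every deterministic two-party protocol $P$ (without help bits) computing $f$ correctly on all inputs (Alice holding $x$, Bob holding $y$, Alice outputting $f(x,y)$) satisfies, for all $x,y\in\{0,1\}^n$, $$CC^P_f(x,y)\ \ge\ \min\{C(x\mid P),\,C(y\mid P)\}-\log n-c.$$
   Context: $C(\cdot\mid\cdot)$ denotes plain conditional Kolmogorov complexity with respect to a fixed reference universal Turing machine; $C(x\mid P)$ is the complexity of $x$ given a description of the protocol $P$. Protocols are deterministic two-party communication protocols in the standard (Yao) sense, knowing the input length $n$; $CC^P_f(x,y)$ is the number of bits exchanged when running $P$ on input $(x,y)$. *)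

(* Defs.v *)
From HB Require Import structures.
From mathcomp Require Import all_boot all_order all_algebra.
From mathcomp Require Import all_classical all_reals all_analysis.

Set Implicit Arguments.
Unset Strict Implicit.
Unset Printing Implicit Defensive.
Import Order.TTheory GRing.Theory Num.Theory.

(** ** Deterministic multitape Turing machines *)

Inductive move := MoveLeft | Stay | MoveRight.

(* [None] is the blank, [Some (inl b)] the bit [b], and [Some (inr a)] an
   auxiliary symbol of the machine. *)
Definition symbol (A : finType) : finType := option (bool + A).

(* Tape 0 initially holds the program, tape 1 the conditional input; tape 2 is
   the output tape, and there are [work] further tapes.  The machine halts when
   [delta] returns [None]. *)
Record machine := Machine {
  work : nat;
  aux : finType;
  state : finType;
  start : state;
  delta : state -> {ffun 'I_work.+3 -> symbol aux} ->
          option (state * ('I_work.+3 -> symbol aux * move)) }.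

(* Tapes are infinite in both directions. *)
Definition tape (A : finType) := int -> symbol A.

Definition word_tape (A : finType) (w : bitseq) : tape A :=
  fun i => if i is Posz k then nth None [seq Some (inl b) | b <- w] k else None.

Record config (M : machine) := Config {
  cstate : state M;
  content : 'I_(work M).+3 -> tape (aux M);
  head : 'I_(work M).+3 -> int }.

Definition init (M : machine) (p z : bitseq) : config M :=
  Config (start M)
    (fun t => word_tape (aux M)
      (match val t with 0 => p | 1 => z | _ => [::] end))
    (fun _ => 0%R).

Definition shift (m : move) (i : int) : int :=
  match m with MoveLeft => (i - 1)%R | Stay => i | MoveRight => (i + 1)%R end.

Definition next (M : machine) (c : config M) : option (config M) :=
  if delta (cstate c) [ffun t => content c t (head c t)] is Some (q, act)
  then Some (Config q
    (fun t i => if i == head c t then (act t).1 else content c t i)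
    (fun t => shift (act t).2 (head c t)))
  else None.

Definition out_tape (M : machine) : 'I_(work M).+3 :=
  @Ordinal (work M).+3 2 isT.

(* [computes M p z x]: on program [p] and conditional input [z], [M] halts, and
   its output tape then contains [x] starting at cell 0 and nothing else. *)
Definition computes (M : machine) (p z x : bitseq) : Prop :=
  exists (t : nat) (c : config M),
    [/\ iter t (obind (@next M)) (Some (init M p z)) = Some c,
        next c = None &
        forall i, content c (out_tape M) i = word_tape (aux M) x i].

(* Every machine is simulated by [U] once its code [w], a (self-delimiting)
   string depending on the machine only, is put in front of the program. *)
Definition universal (U : machine) : Prop :=
  forall M : machine, exists w : bitseq, forall p z x : bitseq,
    computes U (w ++ p) z x <-> computes M p z x.

(** ** Plain conditional Kolmogorov complexity C(x | z) *)

Definition has_program (U : machine) (x z : bitseq) : pred nat :=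
  fun k => `[< exists2 p : bitseq, size p = k & computes U p z x >].

(* The default value 0 is never used when [U] is universal, since then every
   [x] has a program. *)
Definition complexity (U : machine) (x z : bitseq) : nat :=
  if pselect (exists k, has_program U x z k) is left h then ex_minn h else 0.

(** ** Encodings as bit strings *)

(* A number given as conditional input is written in unary; another computable
   encoding changes the complexity by at most an additive constant. *)
Definition unary (n : nat) : bitseq := nseq n true.

(* All words of length [n], in lexicographic order. *)
Fixpoint words (n : nat) : seq (n.-tuple bool) :=
  if n is m.+1 then [seq cons_tuple b w | b <- [:: false; true], w <- words m]
  else [:: nil_tuple bool].

Definition table (n : nat) (a : n.-tuple bool -> bool) : bitseq :=
  [seq a x | x <- words n].

Definition truth_table (n : nat)
    (f : n.-tuple bool -> n.-tuple bool -> bool) : bitseq :=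
  [seq f x y | x <- words n, y <- words n].

(** ** Two-party protocols on inputs of length n *)

(* A protocol tree: at a node [Alice a P0 P1] Alice sends the bit [b = a x] and
   the parties go on with [P0] if [b = false] and [P1] if [b = true]; similarly
   for Bob with [y].  At a leaf [Output a] Alice outputs [a x]: her answer may
   depend on her input as well as on the transcript. *)
Inductive protocol (n : nat) :=
| Output of (n.-tuple bool -> bool)
| Alice of (n.-tuple bool -> bool) & protocol n & protocol n
| Bob of (n.-tuple bool -> bool) & protocol n & protocol n.

Fixpoint run (n : nat) (P : protocol n) (x y : n.-tuple bool) : bool :=
  match P with
  | Output a => a x
  | Alice a P0 P1 => if a x then run P1 x y else run P0 x y
  | Bob b P0 P1 => if b y then run P1 x y else run P0 x y
  end.

Fixpoint cost (n : nat) (P : protocol n) (x y : n.-tuple bool) : nat :=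
  match P with
  | Output _ => 0
  | Alice a P0 P1 => (if a x then cost P1 x y else cost P0 x y).+1
  | Bob b P0 P1 => (if b y then cost P1 x y else cost P0 x y).+1
  end.

Definition solves (n : nat) (P : protocol n)
    (f : n.-tuple bool -> n.-tuple bool -> bool) : Prop :=
  forall x y, run P x y = f x y.

(* Preorder listing of the tree; each node is a tag followed by the truth table
   (of length 2 ^ n) of its function. *)
Fixpoint code (n : nat) (P : protocol n) : bitseq :=
  match P with
  | Output a => false :: table a
  | Alice a P0 P1 => [:: true, false & table a ++ code P0 ++ code P1]
  | Bob b P0 P1 => [:: true, true & table b ++ code P0 ++ code P1]
  end.

Definition description (n : nat) (P : protocol n) : bitseq :=
  unary n ++ false :: code P.

Definition log2 (R : realType) (x : R) : R := (ln x / ln 2)%R.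

(* Main.v *)
Require Import Defs.
From mathcomp Require Import all_boot all_order all_algebra.
From mathcomp Require Import all_classical all_reals all_analysis.
From mathcomp Require Import zify lra.

(* The run of [P] on [(x, y)] singles out a combinatorial rectangle A x B of
   inputs with the same transcript, on which f depends on Alice's input only.  If
   both A and B had more than K n elements, listing K n elements of each
   (O(n) bits per element) and giving f by one bit on each of the chosen rows
   inside B would save about (K n)^2 bits of its truth table, contradicting its
   complexity.  So one side has at most K n elements, and the input on that side
   is recovered from [P], the transcript, and an index of log n + O(1) bits.
   Both decoders are realised by Turing machines whose tapes are used as stacks;
   indices and positions are handled by counting a bit string up to overflow. *)

Set Implicit Arguments.
Unset Strict Implicit.
Unset Printing Implicit Defensive.
Import Order.TTheory GRing.Theory Num.Theory.

(** * Programs whose tapes are stacks of bits *)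

Section StackPrograms.
Variable k : nat.

Notation sym := (symbol void).
Notation reads := {ffun 'I_k.+3 -> sym}.
Notation action := ('I_k.+3 -> sym * move).

Record tapes := Tapes { cells : 'I_k.+3 -> tape void; pos : 'I_k.+3 -> int }.

(** An exit, coded by [None], still performs its action, so that a composite program can turn an
    exit of one part into a jump to the next. *)
Record program := Program {
  node : finType;
  entry : node;
  trans : node -> reads -> option node * action }.

Definition scan (T : tapes) : reads := [ffun t => cells T t (pos T t)].

Definition act (a : action) (T : tapes) : tapes :=
  Tapes (fun t i => if i == pos T t then (a t).1 else cells T t i)
        (fun t => Defs.shift (a t).2 (pos T t)).

Inductive runs (F : program) : node F -> tapes -> tapes -> Prop :=
| RunsExit q T a : trans q (scan T) = (None, a) -> runs q T (act a T)
| RunsStep q q' T T' a : trans q (scan T) = (Some q', a) ->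
    runs q' (act a T) T' -> runs q T T'.

Definition idle (r : reads) : action := fun t => (r t, Stay).

Lemma act_idle T : act (idle (scan T)) T = T.
Proof.
case: T => c h; rewrite /act /idle /=; congr Tapes.
by apply/funext => t; apply/funext => i; rewrite ffunE /=; case: eqP => // ->.
Qed.

(* A stack occupies the cells from the head rightwards; the cells on the left
   of the head are garbage.  Tape 2 is append-only, hence stays clean. *)
Definition holds_at (l : bitseq) (T : tapes) (t : 'I_k.+3) : Prop :=
  if val t == 2 then cells T t =1 word_tape void l /\ pos T t = size l
  else forall j : nat, cells T t (pos T t + j%:Z)%R = word_tape void l j.

(** By the default of [nth], tapes past the end of [s] hold empty stacks. *)
Definition holds (s : seq bitseq) (T : tapes) : Prop :=
  forall t : 'I_k.+3, holds_at (nth [::] s t) T t.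

Lemma act_keep a T t m : a t = (scan T t, m) ->
  cells (act a T) t = cells T t /\ pos (act a T) t = Defs.shift m (pos T t).
Proof.
move=> e; rewrite /= e; split=> //; apply/funext => i /=.
by rewrite ffunE; case: eqP => // ->.
Qed.

Lemma holds_at_stay l a T t : a t = (scan T t, Stay) ->
  holds_at l T t -> holds_at l (act a T) t.
Proof. by move=> /act_keep[+ +]; rewrite /holds_at => -> ->. Qed.

(** Total correctness. Quantifying over all [T] hides the garbage left of the heads, so that
    specifications chain through stack contents alone. *)
Definition exec (F : program) (s s' : seq bitseq) : Prop :=
  forall T, holds s T -> exists2 T', runs (entry F) T T' & holds s' T'.

Definition top (l : bitseq) : sym := if l is b :: _ then Some (inl b) else None.

Lemma scan_top s T (t : 'I_k.+3) : holds s T -> val t != 2 ->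
  scan T t = top (nth [::] s t).
Proof.
move=> /(_ t) + /negPf t2; rewrite /holds_at t2 => /(_ 0).
by rewrite ffunE addr0 => ->; case: nth.
Qed.

Definition skip : program := @Program unit tt (fun _ r => (None, idle r)).

Lemma exec_skip s : exec skip s s.
Proof.
move=> T hT; exists T => //.
by rewrite -{2}(act_idle T); apply: RunsExit.
Qed.

Definition seqp (F G : program) : program :=
  @Program (node F + node G)%type (inl (entry F))
    (fun q r => match q with
     | inl q => let: (o, a) := trans q r in
                (Some (if o is Some q' then inl q' else inr (entry G)), a)
     | inr q => let: (o, a) := trans q r in (omap inr o, a)
     end).

Lemma exec_seq F G s1 s2 s3 :
  exec F s1 s2 -> exec G s2 s3 -> exec (seqp F G) s1 s3.
Proof.
move=> eF eG T /eF [T2 r2 /eG [T3 r3 h3]]; exists T3 => //=.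
have {}r3 : runs (F := seqp F G) (inr (entry G)) T2 T3.
  elim: r3 => [q U a e|q q' U U' a e _ IH].
    by apply: RunsExit; rewrite /= e.
  by apply: RunsStep IH; rewrite /= e.
elim: r2 r3 => [q U a e|q q' U U' a e _ IH] r3.
  by apply: RunsStep r3; rewrite /= e.
by apply: RunsStep (IH r3); rewrite /= e.
Qed.

Definition on (v : nat) (r : reads) (x : sym) (m : move) : action :=
  fun t => if val t == v then (x, m) else (r t, Stay).

(** A transition writes before it moves: the head first steps left, keeping the old top, and the new
    bit is written by a second transition. *)
Definition push (v : nat) (b : bool) : program :=
  @Program bool true (fun q r =>
    if q then (Some false, on v r (r (inord v)) MoveLeft)
    else (None, on v r (Some (inl b)) Stay)).

Lemma exec_push v b s : (v < k.+3) -> v != 2 ->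
  exec (push v b) s (set_nth [::] s v (b :: nth [::] s v)).
Proof.
move=> vk v2 T hT; eexists.
  by apply: RunsStep => //; apply: RunsExit.
move=> t; rewrite nth_set_nth /=; have {hT} := hT t.
have [tv|tv] := eqVneq (val t) v; last first.
  move=> h; do 2![apply: holds_at_stay; first by rewrite /on (negPf tv)].
  exact: h.
have -> : inord v = t by apply: val_inj; rewrite /= inordK.
rewrite /holds_at /on tv (negPf v2) => h j; rewrite /= tv eqxx /=; move: h => /= h.
rewrite ffunE; case: j => [|j]; first by rewrite addr0 eqxx.
have -> : (pos T t - 1 + Posz j.+1 = pos T t + j)%R by lia.
rewrite [X in if X then _ else _](_ : _ = false) ?h; last by lia.
by rewrite /= -tv -h; case: eqP => [e|_]; rewrite ?e.
Qed.

Definition out (b : bool) : program :=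
  @Program unit tt (fun q r => (None, on 2 r (Some (inl b)) MoveRight)).

Lemma word_tape_rcons l b i : word_tape void (rcons l b) i =
  if i == Posz (size l) then Some (inl b) else word_tape void l i.
Proof.
case: i => //= i; rewrite map_rcons nth_rcons size_map.
case: ltngtP => h; rewrite ?eqz_nat ?h ?eqxx //.
- by rewrite (ltn_eqF h).
- by rewrite (gtn_eqF h) nth_default ?size_map // ltnW.
Qed.

Lemma exec_out b s :
  exec (out b) s (set_nth [::] s 2 (rcons (nth [::] s 2) b)).
Proof.
move=> T hT; eexists; first exact: RunsExit.
move=> t; rewrite nth_set_nth /=; have {hT} := hT t.
have [t2|t2 h] := eqVneq (val t) 2; last first.
  by apply: holds_at_stay h; rewrite /on (negPf t2).
rewrite /holds_at t2 /= => -[hc hp]; rewrite /on t2 /= -t2.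
split=> [i|]; last by rewrite hp size_rcons [RHS]intS addrC.
by rewrite word_tape_rcons -hp hc.
Qed.

Definition pop (v : nat) (E F G : program) : program :=
  @Program (option (node E + (node F + node G)))%type None (fun q r =>
    match q with
    | None => match r (inord v) with
       | None => (Some (Some (inl (entry E))), idle r)
       | Some (inl false) =>
           (Some (Some (inr (inl (entry F)))), on v r (r (inord v)) MoveRight)
       | _ => (Some (Some (inr (inr (entry G)))), on v r (r (inord v)) MoveRight)
       end
    | Some (inl q) => let: (o, a) := trans q r in
        (omap (fun q => Some (inl q)) o, a)
    | Some (inr (inl q)) => let: (o, a) := trans q r in
        (omap (fun q => Some (inr (inl q))) o, a)
    | Some (inr (inr q)) => let: (o, a) := trans q r in
        (omap (fun q => Some (inr (inr q))) o, a)
    end).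

Lemma exec_pop v E F G s s' : (v < k.+3) -> v != 2 ->
  match nth [::] s v with
  | [::] => exec E s s'
  | b :: l => exec (if b then G else F) (set_nth [::] s v l) s'
  end -> exec (pop v E F G) s s'.
Proof.
move=> vk v2 + T hT.
(* Runs of a branch carry over to [pop] along any map of nodes that commutes with the
   transitions. *)
have inj (H : program) (i : node H -> node (pop v E F G)) :
    (forall q r, trans (i q) r = (omap i (trans q r).1, (trans q r).2)) ->
    forall q U U', runs q U U' -> runs (i q) U U'.
  move=> hi q U U'; elim=> {q U U'} [q U a e|q q' U U' a e _ IH].
    by apply: RunsExit; rewrite hi e.
  by apply: RunsStep IH; rewrite hi e.
have st := scan_top (t := inord v) hT; rewrite /= inordK // in st.
have {}st := st v2.
case sv: (nth [::] s v) st => [|b l] /= st.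
  move=> /(_ T hT) [T' r h]; exists T' => //.
  apply: (@RunsStep (pop v E F G) None (Some (inl (entry E))) _ _ (idle (scan T))).
    by rewrite /= st.
  rewrite act_idle; apply: (inj E (fun q => Some (inl q))) => // q r' /=.
  by case: (trans q r').
pose a := on v (scan T) (scan T (inord v)) MoveRight.
have {}hT : holds (set_nth [::] s v l) (act a T).
  move=> t; rewrite nth_set_nth /=; have := hT t.
  have [tv|tv h] := eqVneq (val t) v; last first.
    by apply: holds_at_stay h; rewrite /a /on (negPf tv).
  rewrite /holds_at (_ : nth [::] s t = b :: l) ?tv // (negPf v2) => h j.
  have [-> ->] : cells (act a T) t = cells T t /\ pos (act a T) t = (pos T t + 1)%R.
    apply: (@act_keep _ _ _ MoveRight); rewrite /a /on tv eqxx.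
    by congr (scan T _, _); apply: val_inj; rewrite /= inordK.
  by rewrite -addrA (_ : (1 + j%:Z = j.+1)%R) ?h //; lia.
move=> /(_ _ hT) [T' r h]; exists T' => //.
case: b r st {sv} => r st.
- apply: (@RunsStep (pop v E F G) None (Some (inr (inr (entry G)))) _ _ a).
    by rewrite /= st /a st.
  apply: (inj G (fun q => Some (inr (inr q)))) => // q r' /=.
  by case: (trans q r').
- apply: (@RunsStep (pop v E F G) None (Some (inr (inl (entry F)))) _ _ a).
    by rewrite /= st /a st.
  apply: (inj F (fun q => Some (inr (inl q)))) => // q r' /=.
  by case: (trans q r').
Qed.

(** In [Some o] an exit of the body becomes a return to the test node [None]. *)
Definition while (v : nat) (F : program) : program :=
  @Program (option (node F)) None (fun q r =>
    match q with
    | None => (if r (inord v) is None then None else Some (Some (entry F)), idle r)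
    | Some q => let: (o, a) := trans q r in (Some o, a)
    end).

Lemma exec_while_stop v F s : (v < k.+3) -> v != 2 ->
  nth [::] s v = [::] -> exec (while v F) s s.
Proof.
move=> vk v2 sv T hT; exists T => //.
rewrite -{2}(act_idle T); apply: RunsExit => /=.
by have := scan_top (t := inord v) hT; rewrite /= inordK // => ->; rewrite ?sv.
Qed.

Lemma exec_while_step v F s1 s2 s3 : (v < k.+3) -> v != 2 ->
  nth [::] s1 v != [::] -> exec F s1 s2 -> exec (while v F) s2 s3 ->
  exec (while v F) s1 s3.
Proof.
move=> vk v2 sv eF eW T hT.
have [T2 r2 /eW [T3 r3 h3]] := eF T hT; exists T3 => //.
apply: (@RunsStep (while v F) None (Some (entry F)) _ _ (idle (scan T))).
  have := scan_top (t := inord v) hT; rewrite /= inordK // => -> //.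
  by case: nth sv.
rewrite act_idle; elim: r2 r3 => {T hT} [q U a e|q q' U U' a e _ IH] r3.
  by apply: RunsStep r3; rewrite /= e.
by apply: RunsStep (IH r3); rewrite /= e.
Qed.

(** A machine halts without acting while a program acts when it exits; the extra state [None],
    entered on exit, bridges the two. *)
Definition machine_of (F : program) : machine :=
  @Machine k void (option (node F)) (Some (entry F))
    (fun q r => if q is Some q then Some (trans q r) else None).

Lemma machine_of_computes F p z s :
  exec F [:: p; z] s -> computes (machine_of F) p z (nth [::] s 2).
Proof.
pose T := Tapes (Defs.content (init (machine_of F) p z))
  (Defs.head (init (machine_of F) p z)).
move=> /(_ T) [].
  by move=> [[|[|[|t]]] ht] //= j; rewrite add0r //= nth_nil.
move=> T' r hT'.
have [t ht] : exists t, iter t (obind (@Defs.next (machine_of F)))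
    (Some (@Config (machine_of F) (Some (entry F)) (cells T) (pos T))) =
    Some (@Config (machine_of F) None (cells T') (pos T')).
  elim: r => {T T' hT'} [q T a e|q q' T T' a e _ [t IH]].
    by exists 1; rewrite /= /Defs.next /= -/(scan T) e.
  by exists t.+1; rewrite iterSr /= {2}/Defs.next /= -/(scan T) e.
exists t; eexists; split; [exact: ht | by [] |].
by move=> i /=; have [-> _] := hT' (out_tape (machine_of F)).
Qed.

End StackPrograms.

Arguments skip {k}.
Arguments push {k} v b.
Arguments out {k} b.

Notation "F ;; G" := (seqp F G) (at level 60, right associativity).
Notation discard v := (pop v skip skip skip).

Lemma exec_ext k (F : program k) s s1 s2 :
  nth [::] s1 =1 nth [::] s2 -> exec F s s1 -> exec F s s2.
Proof.
move=> e eF T /eF [T' r h]; exists T' => // t.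
by rewrite -e; apply: h.
Qed.

Definition transfer k v u : program k := pop v skip (push u false) (push u true).

Lemma exec_transfer k v u b l s : v < k.+3 -> u < k.+3 -> v != 2 -> u != 2 ->
  v != u -> nth [::] s v = b :: l ->
  exec (transfer k v u) s
    (set_nth [::] (set_nth [::] s v l) u (b :: nth [::] s u)).
Proof.
move=> vk uk v2 u2 vu sv; apply: exec_pop; rewrite ?sv //.
have := @exec_push k u b (set_nth [::] s v l) uk u2.
by rewrite nth_set_nth /= eq_sym (negPf vu); case: (b).
Qed.

Definition move_stack k v u : program k :=
  while v (transfer k v u).

(** Each move reverses the word, so a loop that builds its result on another stack is followed by a
    move back. *)
Lemma exec_move k v u s : v < k.+3 -> u < k.+3 -> v != 2 -> u != 2 -> v != u ->
  exec (move_stack k v u) s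
    (set_nth [::] (set_nth [::] s v [::]) u (catrev (nth [::] s v) (nth [::] s u))).
Proof.
move=> vk uk v2 u2 vu.
have [l sv] : {l | nth [::] s v = l} by exists (nth [::] s v).
rewrite sv; elim: l s sv => [|b l IH] s sv.
  apply: exec_ext (exec_while_stop _ vk v2 sv) => i.
  rewrite !nth_set_nth /= nth_set_nth /=.
  by have [->|_] := eqVneq i u; last have [->|_] := eqVneq i v.
apply: (@exec_while_step _ _ _ _
  (set_nth [::] (set_nth [::] s v l) u (b :: nth [::] s u))) => //.
- by rewrite sv.
- exact: exec_transfer.
- set s2 := set_nth _ _ u _.
  have s2u : nth [::] s2 u = b :: nth [::] s u by rewrite nth_set_nth /= eqxx.
  apply: exec_ext (IH s2 _) => [i|].
    rewrite s2u !nth_set_nth /= !nth_set_nth /=.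
    have [//|/negPf iu] := eqVneq i u; have [//|/negPf iv] := eqVneq i v.
    by rewrite nth_set_nth /= iu nth_set_nth /= iv.
  by rewrite nth_set_nth /= (negPf vu) nth_set_nth /= eqxx.
Qed.

Arguments transfer {k} v u.
Arguments move_stack {k} v u.

Lemma exec_discard k v (s : seq bitseq) : v < k.+3 -> v != 2 ->
  exec (discard v : program k) s (set_nth [::] s v (behead (nth [::] s v))).
Proof.
move=> vk v2; apply: exec_pop => //.
case sv: nth => [|b l] /=; last by case: (b); apply: exec_skip.
apply: exec_ext (@exec_skip _ s) => i.
by rewrite nth_set_nth /=; have [->|//] := eqVneq i v.
Qed.

(** * Counting with bit strings *)

(* Tape 3 holds a word used as a counter, tape 4 is scratch, tapes 5 to 7 hold
   sets of words as bit masks (tape 7 also the number of subtrees left to skip),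
   and tapes 8 to 10 hold loop flags. *)
Notation prog := (program 8).

(* The least significant bit comes first; the all-ones word wraps around. *)
Fixpoint incr (l : bitseq) : bitseq :=
  match l with
  | [::] => [::]
  | false :: l => true :: l
  | true :: l => false :: incr l
  end.

(* On overflow, a mark is removed from tape 9. *)
Definition increment c : prog :=
  push 8 true ;;
  while 8 (pop c (discard 8 ;; discard 9) (push c true ;; discard 8) (push 4 false)) ;;
  move_stack 4 c.

Ltac step := first
  [ by apply: exec_push | by apply: exec_out | by apply: exec_skip
  | by apply: exec_move | by apply: exec_transfer | by apply: exec_discard
  | apply: exec_pop => //= ].
Ltac execute := repeat first [ step | apply: exec_seq ]; rewrite //=.
Ltac loop := apply: exec_while_step => //=.
Ltac stop := apply: exec_while_stop => //=.

Lemma catrev_nseq (T : Type) n (x : T) l : catrev (nseq n x) l = nseq n x ++ l.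
Proof. by elim: n l => //= n IH l; rewrite IH; elim: n {IH} => //= n ->. Qed.

Lemma exec_increment c p z o w m m' q k g l
    (s := fun l t f k => set_nth [::] [:: p; z; o; w; t; m; m'; q; f; k; g] c l) :
  c \in [:: 0; 3] ->
  exec (increment c) (s l [::] [::] k)
    (s (incr l) [::] [::] (if all id l then behead k else k)).
Proof.
move=> hc.
(* Here [j] counts the carries, parked as zeros on tape 4, and [r] is what remains on the counter;
   [t] zeros were parked before. *)
have h t : exists j r, incr l = nseq j false ++ r /\
    exec (while 8 (pop c (discard 8 ;; discard 9) (push c true ;; discard 8)
      (push 4 false)) : prog)
      (s l (nseq t false) [:: true] k)
      (s r (nseq (t + j) false) [::] (if all id l then behead k else k)).
  elim: l t => [|[] l IH] t.
  - exists 0, [::]; split=> //; rewrite addn0.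
    by move: hc; rewrite !inE => /orP[] /eqP ?; subst c; loop; execute; stop.
  - have [j [r [jr h]]] := IH t.+1; exists j.+1, r; split; first by rewrite /= jr.
    rewrite addnS -addSn.
    by move: hc h; rewrite !inE => /orP[] /eqP ?; subst c => h; (loop; [execute|exact: h]).
  - exists 0, (true :: l); split=> //; rewrite addn0.
    by move: hc; rewrite !inE => /orP[] /eqP ?; subst c; (loop; [execute|stop]).
have [j [r [-> {}h]]] := h 0; rewrite -catrev_nseq.
by move: hc h; rewrite !inE => /orP[] /eqP ?; subst c => h; (execute; first exact: h; execute).
Qed.

Lemma exec_incr3 p z o c m m' q k g :
  exec (increment 3) [:: p; z; o; c; [::]; m; m'; q; [::]; k; g]
    [:: p; z; o; incr c; [::]; m; m'; q; [::]; if all id c then behead k else k; g].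
Proof. exact: (@exec_increment 3 p z o [::] m m' q k g c). Qed.

Lemma exec_incr0 p z o c m m' q k g :
  exec (increment 0) [:: p; z; o; c; [::]; m; m'; q; [::]; k; g]
    [:: incr p; z; o; c; [::]; m; m'; q; [::]; if all id p then behead k else k; g].
Proof. exact: (@exec_increment 0 [::] z o c m m' q k g p). Qed.

Ltac step ::= first
  [ by apply: exec_push | by apply: exec_out | by apply: exec_skip
  | by apply: exec_move | by apply: exec_transfer | by apply: exec_discard
  | by apply: exec_incr3 | by apply: exec_incr0 | apply: exec_pop => //= ].

(* A nonempty such [r] ends with the all-ones word, so a counter started at its
   head overflows after exactly [size r] increments. *)
Fixpoint consecutive n (r : seq bitseq) : Prop :=
  if r is u :: r' then
    [/\ all id u = nilp r', incr u = head (nseq n false) r' & consecutive n r']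
  else True.

Lemma consecutive_cat n r r' : consecutive n (r ++ r') -> consecutive n r'.
Proof. by elim: r => //= u r IH [_ _ /IH]. Qed.

(** Counters have their least significant bit first, so lexicographic order becomes counting order
    after reversal. *)
Definition rwords n : seq bitseq := [seq rev w | w : n.-tuple bool <- words n].

Lemma rcons_nseq (T : Type) n (x : T) : rcons (nseq n x) x = nseq n.+1 x.
Proof. by elim: n => //= n ->. Qed.

Lemma rwordsS n :
  rwords n.+1 = [seq rcons u false | u <- rwords n] ++ [seq rcons u true | u <- rwords n].
Proof.
rewrite /rwords /= cats0 map_cat -!map_comp.
by congr cat; apply: eq_map => w /=; rewrite rev_cons.
Qed.

Lemma size_rwords n : size (rwords n) = 2 ^ n.
Proof.
elim: n => // n IH.
by rewrite rwordsS size_cat (size_map (rcons^~ false)) (size_map (rcons^~ true))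
  IH expnS mul2n addnn.
Qed.

Lemma head_rwords n : exists r, rwords n = nseq n false :: r.
Proof.
elim: n => [|n [r e]]; first by exists [::].
by rewrite rwordsS e /= rcons_nseq; eexists.
Qed.

Lemma incr_rcons u b : incr (rcons u b) =
  if all id u then rcons (incr u) (~~ b) else rcons (incr u) b.
Proof. by elim: u => [|[] u IH] /=; [case: b| rewrite IH; case: ifP|]. Qed.

Lemma incr_full u : all id u -> incr u = nseq (size u) false.
Proof. by elim: u => [|[] u IH] //= /IH ->. Qed.

Lemma size_rwords_mem n u : u \in rwords n -> size u = n.
Proof. by move=> /mapP[w _ ->]; rewrite size_rev size_tuple. Qed.

(** In length [n.+1] the last, most significant bit is false on the first half and true on the
    second; the overflow of the low bits joins the halves. *)
Lemma consecutive_rwords n : consecutive n (rwords n).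
Proof.
elim: n => // n IH; rewrite rwordsS.
have [r0 e0] := head_rwords n.
have sub : {subset rwords n <= rwords n} by [].
(* The inclusion is carried along only to know that the words of [r] have length [n]. *)
have hT r : {subset r <= rwords n} -> consecutive n r ->
    consecutive n.+1 [seq rcons u true | u <- r].
  elim: r => //= u r IHr su [au iu /IHr cr]; split.
  - by rewrite all_rcons /= au; case: (r).
  - rewrite incr_rcons; have su' := size_rwords_mem (su u (mem_head _ _)).
    case: ifP => [h|h]; first rewrite incr_full // su'.
      move: au; rewrite h; case: (r) => //= _.
      by rewrite rcons_nseq.
    by rewrite iu; move: au; rewrite h; case: (r).
  - by apply: cr => v vr; apply: su; rewrite inE vr orbT.
have hF r : {subset r <= rwords n} -> consecutive n r ->
    consecutive n.+1 ([seq rcons u false | u <- r] ++ [seq rcons u true | u <- rwords n]).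
  elim: r => [_ _|u r IHr su [au iu /IHr cr]]; first exact: hT.
  split.
  - by rewrite all_rcons /= e0; case: (r).
  - rewrite incr_rcons; have su' := size_rwords_mem (su u (mem_head _ _)).
    move: au; case: ifP => [h|h].
      rewrite incr_full // su'; case: (r) => //= _; by rewrite e0.
    by rewrite iu; case: (r).
  - by apply: cr => v vr; apply: su; rewrite inE vr orbT.
exact: hF.
Qed.

Lemma uniq_words n : uniq (words n).
Proof.
elim: n => // n IH; rewrite /= cats0 cat_uniq !map_inj_uniq ?IH ?andbT /=.
- apply/hasPn => w /mapP[u _ ->]; apply/mapP => -[v _ /(congr1 val)] //.
- by move=> u v /(congr1 val) [] /val_inj.
- by move=> u v /(congr1 val) [] /val_inj.
Qed.

Lemma uniq_rwords n : uniq (rwords n).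
Proof. by rewrite map_inj_uniq ?uniq_words // => u v /(can_inj revK) /val_inj. Qed.

Lemma mem_words n (w : n.-tuple bool) : w \in words n.
Proof.
elim: n w => [|n IH] w; first by rewrite tuple0 mem_head.
have -> : w = cons_tuple (thead w) (behead_tuple w).
  by rewrite [LHS]tuple_eta; apply: val_inj.
rewrite /= cats0 mem_cat; case: (thead w); rewrite ?[X in X || _]map_f ?IH //.
by rewrite [X in _ || X]map_f ?orbT ?IH.
Qed.

Definition zeros : prog :=
  push 10 true ;; while 10 (pop 1 (discard 10) (discard 10) (push 3 false)).

(** The option covers both kinds of conditional input: bare [unary n], and a protocol description,
    whose unary part ends with a false bit. *)
Lemma exec_zeros n p z o m m' q k :
  exec zeros [:: p; nseq n true ++ (if z is Some z then false :: z else [::]);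
      o; [::]; [::]; m; m'; q; [::]; k; [::]]
    [:: p; odflt [::] z; o; nseq n false; [::]; m; m'; q; [::]; k; [::]].
Proof.
have h c : exec (while 10 (pop 1 (discard 10) (discard 10) (push 3 false)) : prog)
    [:: p; nseq n true ++ (if z is Some z then false :: z else [::]);
      o; c; [::]; m; m'; q; [::]; k; [:: true]]
    [:: p; odflt [::] z; o; nseq n false ++ c; [::]; m; m'; q; [::]; k; [::]].
  elim: n c => [|n IH] c; last first.
    have -> : nseq n.+1 false ++ c = nseq n false ++ false :: c.
      by rewrite -rcons_nseq cat_rcons.
    by loop; execute.
  by case: z => [z|] /=; (loop; [execute|stop]).
by have := h [::]; rewrite cats0 => {}h; execute.
Qed.

Definition fill b : prog := push 9 true ;; while 9 (push 6 b ;; increment 3).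

Lemma exec_fill n b p z o m m' q g :
  exec (fill b) [:: p; z; o; nseq n false; [::]; m; m'; q; [::]; [::]; g]
    [:: p; z; o; nseq n false; [::]; m; nseq (2 ^ n) b ++ m'; q; [::]; [::]; g].
Proof.
(* From [u] the counter overflows after [size r + 1] increments; started at zero, this gives [2 ^ n]
   turns. *)
have h u r t : consecutive n (u :: r) ->
    exec (while 9 (push 6 b ;; increment 3) : prog)
      [:: p; z; o; u; [::]; m; t; q; [::]; [:: true]; g]
      [:: p; z; o; nseq n false; [::]; m; nseq (size r).+1 b ++ t; q; [::]; [::]; g].
  elim: r u t => [|v r IH] u t /= [/= au iu cr]; loop; execute; rewrite au iu /=.
    by stop.
  have -> : [:: b, b & nseq (size r) b ++ t] = nseq (size r).+1 b ++ b :: t.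
    by rewrite -cat_rcons (rcons_nseq (size r).+1).
  exact: IH.
execute; rewrite -size_rwords; have := consecutive_rwords n.
by have [r ->] := head_rwords n; apply: h.
Qed.

(** * Decoding a truth table with a row-constant rectangle *)

(** The old counter serves as a ruler: it tells how many program bits form one word. *)
Definition load : prog :=
  while 3 (discard 3 ;; transfer 0 4) ;;
  move_stack 4 3.

Lemma exec_load p z o c m m' q k g u : size c = size u ->
  exec load [:: u ++ p; z; o; c; [::]; m; m'; q; [::]; k; g]
    [:: p; z; o; u; [::]; m; m'; q; [::]; k; g].
Proof.
have h t : size c = size u ->
    exec (while 3 (discard 3 ;; transfer 0 4) : prog)
      [:: u ++ p; z; o; c; t; m; m'; q; [::]; k; g]
      [:: p; z; o; [::]; catrev u t; m; m'; q; [::]; k; g].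
  elim: c u t => [|a c IH] [|b u] t //= => [_|[su]]; first by stop.
  by loop; last exact: IH su; execute.
move=> su; apply: exec_seq; first exact: h.
by rewrite /= -{2}[u]revK /rev; execute.
Qed.

(* Sets the bit of the word on tape 3 in the mask which tape 6 holds in reverse:
   the bit lies as deep as the number of increments that overflow takes. *)
Definition mark : prog :=
  push 9 true ;;
  while 9 (transfer 6 5 ;; increment 3) ;;
  discard 5 ;; push 5 true ;; move_stack 5 6.

Lemma exec_mark n p z o q g u post a b l : consecutive n (u :: post) ->
  size a = size post ->
  exec mark [:: p; z; o; u; [::]; [::]; rev a ++ b :: l; q; [::]; [::]; g]
    [:: p; z; o; nseq n false; [::]; [::]; rev a ++ true :: l; q; [::]; [::]; g].
Proof.
have h v r x y t : consecutive n (v :: r) -> size x = size r ->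
    exec (while 9 (transfer 6 5 ;; increment 3) : prog)
      [:: p; z; o; v; [::]; t; x ++ y :: l; q; [::]; [:: true]; g]
      [:: p; z; o; nseq n false; [::]; y :: catrev x t; l; q; [::]; [::]; g].
  elim: r v x t => [|w r IH] v [|b' x] t //= [au iu cr] => [_|[sx]].
    by loop; execute; rewrite au iu; stop.
  by loop; execute; rewrite au iu; exact: IH.
move=> cr sa; rewrite /mark; apply: exec_seq; first by execute.
apply: exec_seq; first by apply: h cr _; rewrite size_rev.
rewrite -/(rev (rev a)) revK; execute.
by rewrite -catrevE; exact: exec_move.
Qed.

Definition read_set : prog :=
  push 10 true ;; while 10 (pop 0 skip (discard 10) (load ;; mark)).

Lemma exec_read_set n p z o q (us : seq bitseq) :
  {subset us <= rwords n} ->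
  exec read_set
    [:: flatten [seq true :: u | u <- us] ++ false :: p; z; o; nseq n false;
      [::]; [::]; nseq (2 ^ n) false; q; [::]; [::]; [::]]
    [:: p; z; o; nseq n false; [::]; [::]; rev [seq u \in us | u <- rwords n];
      q; [::]; [::]; [::]].
Proof.
(* The predicate [f] stands for the mask accumulated so far. *)
have h (f : pred bitseq) : {subset us <= rwords n} ->
    exec (while 10 (pop 0 skip (discard 10) (load ;; mark)) : prog)
    [:: flatten [seq true :: u | u <- us] ++ false :: p; z; o; nseq n false;
      [::]; [::]; rev [seq f u | u <- rwords n]; q; [::]; [::]; [:: true]]
    [:: p; z; o; nseq n false; [::]; [::];
      rev [seq f u || (u \in us) | u <- rwords n]; q; [::]; [::]; [::]].
  elim: us f => [|u us IH] f sub.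
    loop; execute.
    by rewrite (eq_map (fun u => orbF (f u))); stop.
  have uW : u \in rwords n by apply: sub; exact: mem_head.
  have {}sub : {subset us <= rwords n} by move=> v h; apply: sub; rewrite inE h orbT.
  have su := size_rwords_mem uW.
  have := consecutive_rwords n; have := uniq_rwords n.
  have {}IH := IH (fun v => f v || (v == u)) sub.
  have -> : [seq f v || (v \in u :: us) | v <- rwords n] =
      [seq (f v || (v == u)) || (v \in us) | v <- rwords n].
    by apply: eq_map => v; rewrite inE orbA.
  (* As the enumeration has no repetition, only the cell between [pre] and [post] changes, and its
     depth in the reversed mask is [size post]. *)
  case/path.splitPr: uW IH => pre post IH.
  rewrite cat_uniq /= => /and3P[_ /norP[upre _] /andP[upost _]].
  move/consecutive_cat => cr.
  apply: exec_while_step IH => //.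
  apply: exec_pop => //=; rewrite -catA.
  apply: exec_seq; first by apply: exec_load; rewrite size_nseq su.
  rewrite !map_cat /= !rev_cat /= !rev_cons !cat_rcons.
  have e r : u \notin r -> [seq f v || (v == u) | v <- r] = [seq f v | v <- r].
    move=> ur; apply/eq_in_map => v vr; case: eqP => [vu|_]; rewrite ?orbF //.
    by rewrite -vu vr in ur.
  rewrite !e // eqxx orbT.
  by apply: exec_mark cr _; rewrite size_map.
move=> us_sub; execute.
have -> : nseq (2 ^ n) false = rev [seq false | u <- rwords n].
  by rewrite -size_rwords; elim: rwords => //= w r IH; rewrite rev_cons -IH rcons_nseq.
exact: (h pred0 us_sub).
Qed.

Definition copy : prog := pop 0 skip (out false) (out true).

Lemma exec_copy b p s : exec copy [:: b :: p & s]
  (set_nth [::] [:: p & s] 2 (rcons (nth [::] [:: p & s] 2) b)).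
Proof. by apply: exec_pop => //=; case: b; apply: exec_out. Qed.

Ltac step ::= first
  [ by apply: exec_push | by apply: exec_out | by apply: exec_skip
  | by apply: exec_move | by apply: exec_transfer | by apply: exec_discard
  | by apply: exec_incr3 | by apply: exec_incr0 | by apply: exec_copy
  | apply: exec_pop => //= ].

(* Outputs one row of the truth table; the cells in the columns marked on tape 5
   are produced by [F], the others are copied from the program. *)
Definition row (F : prog) : prog :=
  while 5 (pop 5 skip (push 6 false ;; copy) (push 6 true ;; F)) ;; move_stack 6 5.

(** The string [e w] is what [F] consumes for one cell: nothing when the bit of the row is already
    known, one bit when it is copied. *)
Lemma exec_row (T : Type) (B g : T -> bool) (e : T -> bitseq) F p z o c q k h ws :
  (forall w p o m m', B w ->
     exec F [:: e w ++ p; z; o; c; [::]; m; m'; q; [::]; k; h]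
       [:: p; z; rcons o (g w); c; [::]; m; m'; q; [::]; k; h]) ->
  exec (row F)
    [:: flatten [seq if B w then e w else [:: g w] | w <- ws] ++ p; z; o; c; [::];
      [seq B w | w <- ws]; [::]; q; [::]; k; h]
    [:: p; z; o ++ [seq g w | w <- ws]; c; [::];
      [seq B w | w <- ws]; [::]; q; [::]; k; h].
Proof.
move=> eF.
have H o' m' : exec (while 5 (pop 5 skip (push 6 false ;; copy) (push 6 true ;; F)) : prog)
    [:: flatten [seq if B w then e w else [:: g w] | w <- ws] ++ p; z; o'; c; [::];
      [seq B w | w <- ws]; m'; q; [::]; k; h]
    [:: p; z; o' ++ [seq g w | w <- ws]; c; [::];
      [::]; catrev [seq B w | w <- ws] m'; q; [::]; k; h].
  elim: ws o' m' => [|w ws IH] o' m' /=; first by rewrite cats0; stop.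
  rewrite -cat_rcons -catA; apply: exec_while_step (IH _ _) => //.
  apply: exec_pop => //=; case Bw: (B w); execute; exact: eF.
apply: exec_seq; first exact: H.
by rewrite -/(rev _) -{2}[[seq B w | w <- ws]]revK /rev; exact: exec_move.
Qed.

(** Masks come out of [read_set] reversed, and the moves to tapes 7 (rows) and 5 (columns) restore
    their order. A marked row first yields its common bit, which chooses between the two versions of
    [row]. *)
Definition decode_table : prog :=
  zeros ;; fill false ;; read_set ;; move_stack 6 7 ;;
  fill false ;; read_set ;; move_stack 6 5 ;;
  while 7 (pop 7 skip (row copy) (pop 0 skip (row (out false)) (row (out true)))).

(** A true bit announces each word and a false bit ends the list, which makes the code
    self-delimiting. *)
Definition set_code n (A : seq (n.-tuple bool)) : bitseq :=
  flatten [seq true :: rev w | w : n.-tuple bool <- A] ++ [:: false].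

(** In a row of [A], the single bit [a x] replaces all entries in the columns of [B]. *)
Definition table_code n (A B : seq (n.-tuple bool)) (a : n.-tuple bool -> bool)
    (f : n.-tuple bool -> n.-tuple bool -> bool) : bitseq :=
  set_code A ++ set_code B ++
  flatten [seq (if x \in A then [:: a x] else [::]) ++
     flatten [seq if (x \in A) && (y \in B) then [::] else [:: f x y] | y <- words n]
     | x <- words n].

Lemma exec_read_set_code n p z o q (A : seq (n.-tuple bool)) :
  exec read_set
    [:: set_code A ++ p; z; o; nseq n false;
      [::]; [::]; nseq (2 ^ n) false; q; [::]; [::]; [::]]
    [:: p; z; o; nseq n false; [::]; [::]; rev [seq w \in A | w <- words n];
      q; [::]; [::]; [::]].
Proof.
have := @exec_read_set n p z o q [seq rev w | w : n.-tuple bool <- A].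
rewrite -map_comp -catA /= => h.
have -> : [seq w \in A | w <- words n] =
    [seq u \in [seq rev w | w : n.-tuple bool <- A] | u <- rwords n].
  rewrite -map_comp; apply: eq_map => w /=.
  by rewrite (mem_map (f := fun w : n.-tuple bool => rev w)) // => u v /(can_inj revK) /val_inj.
by apply: h => _ /mapP[w _ ->]; apply: map_f; apply: mem_words.
Qed.

Lemma decode_table_computes n (A B : seq (n.-tuple bool))
    (a : n.-tuple bool -> bool) (f : n.-tuple bool -> n.-tuple bool -> bool) :
  (forall x y, x \in A -> y \in B -> f x y = a x) ->
  computes (machine_of decode_table) (table_code A B a f) (unary n) (truth_table f).
Proof.
move=> fa.
pose wA := [seq w \in A | w <- words n]; pose wB := [seq w \in B | w <- words n].
(* The nine implicit empty stacks are spelled out, so that the rules for programs apply by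
   computation. *)
suff : exec decode_table
    [:: table_code A B a f; unary n; [::]; [::]; [::]; [::]; [::]; [::]; [::]; [::]; [::]]
    [:: [::]; [::]; truth_table f; nseq n false; [::]; wB; [::]; [::]; [::]; [::]; [::]].
  move=> h; apply: (machine_of_computes
    (s := [:: [::]; [::]; truth_table f; nseq n false; [::]; wB; [::]; [::]; [::]; [::]; [::]])).
  move=> T hT; apply: h => t; have := hT t.
  by move: t => [[|[|[|[|[|[|[|[|[|[|[|t]]]]]]]]]]] ht] //=; rewrite nth_nil.
have z0 := @exec_zeros n (table_code A B a f) None [::] [::] [::] [::] [::].
rewrite /= cats0 in z0.
apply: exec_seq; first exact: z0.
apply: exec_seq; first exact: exec_fill.
rewrite cats0; apply: exec_seq; first exact: exec_read_set_code.
apply: exec_seq; first exact: exec_move.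
rewrite /= -/(rev (rev _)) revK.
apply: exec_seq; first exact: exec_fill.
rewrite cats0; apply: exec_seq; first exact: exec_read_set_code.
apply: exec_seq; first exact: exec_move.
rewrite /= -/(rev (rev _)) revK -/wB.
pose body x := (if x \in A then [:: a x] else [::]) ++
  flatten [seq if (x \in A) && (y \in B) then [::] else [:: f x y] | y <- words n].
suff H ws o : exec (while 7
    (pop 7 skip (row copy) (pop 0 skip (row (out false)) (row (out true)))) : prog)
    [:: flatten [seq body x | x <- ws]; [::]; o; nseq n false; [::]; wB; [::];
      [seq x \in A | x <- ws]; [::]; [::]; [::]]
    [:: [::]; [::]; o ++ flatten [seq [seq f x y | y <- words n] | x <- ws];
      nseq n false; [::]; wB; [::]; [::]; [::]; [::]; [::]].
  exact: H.
elim: ws o => [|x ws IH] o /=; first by rewrite cats0; stop.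
rewrite catA; apply: exec_while_step (IH _) => //.
apply: exec_pop => //=; rewrite /body; have [xA|xA] /= := boolP (x \in A).
  have h : exec (row (out (a x)))
      [:: flatten [seq if y \in B then [::] else [:: f x y] | y <- words n] ++
        flatten [seq body x | x <- ws]; [::]; o; nseq n false; [::]; wB; [::];
        [seq x \in A | x <- ws]; [::]; [::]; [::]]
      [:: flatten [seq body x | x <- ws]; [::]; o ++ [seq f x y | y <- words n];
        nseq n false; [::]; wB; [::]; [seq x \in A | x <- ws]; [::]; [::]; [::]].
    by apply: exec_row => y p o' m m' yB; rewrite (fa x y) //; exact: exec_out.
  by apply: exec_pop => //=; case: (a x) h.
have h := @exec_row _ (fun y => y \in B) (f x) (fun y => [:: f x y]) copy.
rewrite (eq_map (g := fun y => if y \in B then [:: f x y] else [:: f x y])).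
  by apply: h => y p o' m m' _; exact: exec_copy.
by move=> y; rewrite if_same.
Qed.

(** * Length of the code of a truth table *)

Lemma size_words n : size (words n) = 2 ^ n.
Proof. by rewrite -size_rwords size_map. Qed.

Lemma size_set_code n (A : seq (n.-tuple bool)) : size (set_code A) = size A * n.+1 + 1.
Proof.
rewrite size_cat; congr addn; rewrite mulnC.
by elim: A => [|w A IH]; rewrite ?muln0 //= size_cat IH size_rev size_tuple mulnS.
Qed.

Lemma count_words n (A : seq (n.-tuple bool)) : uniq A ->
  count [in A] (words n) = size A.
Proof.
move=> uA; rewrite -size_filter; apply: perm_size; apply: uniq_perm => //.
  by rewrite filter_uniq ?uniq_words.
by move=> w; rewrite mem_filter mem_words andbT.
Qed.

(** Naming an element costs [n.+1] bits, a row of [A] one more for its common bit, and the two lists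
    end with one bit each. The saving stands on the left to avoid truncated subtraction. *)
Lemma size_table_code n (A B : seq (n.-tuple bool)) a f : uniq A -> uniq B ->
  size (table_code A B a f) + size A * size B =
  2 ^ (2 * n) + size A * n.+2 + size B * n.+1 + 2.
Proof.
move=> uA uB; rewrite /table_code (size_cat (set_code A)) (size_cat (set_code B)) !size_set_code.
pose row x := (if x \in A then [:: a x] else [::]) ++
  flatten [seq if (x \in A) && (y \in B) then [::] else [:: f x y] | y <- words n].
suff H ws : size (flatten [seq row x | x <- ws]) + count [in A] ws * size B =
    size ws * 2 ^ n + count [in A] ws.
  have := H (words n); rewrite count_words // size_words -expnD addnn -mul2n.
  by rewrite /row; lia.
elim: ws => // x ws IH; rewrite [flatten _]/= size_cat.
suff : size (row x) + (x \in A) * size B = 2 ^ n + (x \in A) by move=> h; rewrite /= mulnDl mulSn addnACA h IH addnACA.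
rewrite /row size_cat -(count_words uB) -(size_words n).
suff h b ys : size (flatten [seq if b && (y \in B) then [::] else [:: f x y] | y <- ys])
    + b * count [in B] ys = size ys by have := h (x \in A) (words n); case: (x \in A) => /=; lia.
elim: ys => [|y ys IHy] /=; first by rewrite muln0.
by move: IHy; rewrite size_cat; case: b; case: (y \in B) => /=; lia.
Qed.

(** * Decoding an input from a transcript *)

(* The rectangle of inputs on which [P] runs as it does on [(x, y)], projected
   on Alice's side or on Bob's. *)
Fixpoint fibre (alice : bool) n (P : protocol n) (x y w : n.-tuple bool) : bool :=
  match P with
  | Output _ => true
  | Alice a P0 P1 =>
      (alice ==> (a w == a x)) && fibre alice (if a x then P1 else P0) x y w
  | Bob b P0 P1 =>
      (~~ alice ==> (b w == b y)) && fibre alice (if b y then P1 else P0) x y w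
  end.

Fixpoint transcript n (P : protocol n) (x y : n.-tuple bool) : bitseq :=
  match P with
  | Output _ => [::]
  | Alice a P0 P1 => a x :: transcript (if a x then P1 else P0) x y
  | Bob b P0 P1 => b y :: transcript (if b y then P1 else P0) x y
  end.

Fixpoint leaf n (P : protocol n) (x y : n.-tuple bool) : n.-tuple bool -> bool :=
  match P with
  | Output a => a
  | Alice a P0 P1 => leaf (if a x then P1 else P0) x y
  | Bob b P0 P1 => leaf (if b y then P1 else P0) x y
  end.

Lemma size_transcript n (P : protocol n) x y : size (transcript P x y) = cost P x y.
Proof. by elim: P => //= [a|b] P0 IH0 P1 IH1; case: ifP; rewrite ?IH0 ?IH1. Qed.

Lemma fibre_alice n (P : protocol n) x y : fibre true P x y x.
Proof. by elim: P => //= [a|b] P0 IH0 P1 IH1; rewrite ?eqxx /=; case: ifP. Qed.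

Lemma fibre_bob n (P : protocol n) x y : fibre false P x y y.
Proof. by elim: P => //= [a|b] P0 IH0 P1 IH1; rewrite ?eqxx /=; case: ifP. Qed.

(** Alice's nodes look only at [u] and Bob's only at [v], so [(u, v)] follows the path of [(x, y)]
    to the same leaf, where the answer depends on [u] alone. *)
Lemma run_leaf n (P : protocol n) x y u v :
  fibre true P x y u -> fibre false P x y v -> run P u v = leaf P x y u.
Proof.
elim: P => //= [a|b] P0 IH0 P1 IH1.
- by case/andP=> /eqP ->; case: ifP => _; [apply: IH1|apply: IH0].
- by move=> fu /andP[/eqP -> fv]; move: fu fv; case: ifP => _; [apply: IH1|apply: IH0].
Qed.

(** The mask on tape 5 has the length of a node's table and so measures what to drop. *)
Definition skip_table : prog :=
  while 5 (transfer 5 6 ;; discard 1) ;; move_stack 6 5.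

Lemma exec_skip_table p a z o c m q k g : size a = size m ->
  exec skip_table [:: p; a ++ z; o; c; [::]; m; [::]; q; [::]; k; g]
    [:: p; z; o; c; [::]; m; [::]; q; [::]; k; g].
Proof.
have h t : size a = size m -> exec (while 5 (transfer 5 6 ;; discard 1) : prog)
    [:: p; a ++ z; o; c; [::]; m; t; q; [::]; k; g]
    [:: p; z; o; c; [::]; [::]; catrev m t; q; [::]; k; g].
  elim: a m t => [|b a IH] [|b' m] t //= => [_|[sm]]; first by stop.
  by apply: exec_while_step (IH _ _ sm) => //; execute.
move=> sm; apply: exec_seq; first exact: h.
by rewrite -/(rev m) -{2}[m]revK /rev; exact: exec_move.
Qed.

Definition restrict b : prog :=
  while 5 (pop 5 skip (discard 1 ;; push 6 false)
                      (pop 1 skip (push 6 (~~ b)) (push 6 b))) ;;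
  move_stack 6 5.

Lemma exec_restrict (T : Type) (B a : T -> bool) b ws p z o c q k g :
  exec (restrict b)
    [:: p; [seq a w | w <- ws] ++ z; o; c; [::]; [seq B w | w <- ws]; [::]; q; [::]; k; g]
    [:: p; z; o; c; [::]; [seq B w && (a w == b) | w <- ws]; [::]; q; [::]; k; g].
Proof.
have h t : exec (while 5 (pop 5 skip (discard 1 ;; push 6 false)
                 (pop 1 skip (push 6 (~~ b)) (push 6 b))) : prog)
    [:: p; [seq a w | w <- ws] ++ z; o; c; [::]; [seq B w | w <- ws]; t; q; [::]; k; g]
    [:: p; z; o; c; [::]; [::]; catrev [seq B w && (a w == b) | w <- ws] t; q; [::]; k; g].
  elim: ws t => [|w ws IH] t /=; first by stop.
  apply: exec_while_step (IH _) => //; apply: exec_pop => //=.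
  case: (B w); last by execute.
  by apply: exec_pop => //=; case: (a w); case: (b); execute.
apply: exec_seq; first exact: h.
by rewrite -/(rev _) -{2}[[seq _ && _ | w <- _]]revK /rev; exact: exec_move.
Qed.

(** In preorder a count of pending subtrees suffices: a leaf removes one, an inner node replaces one
    by two. *)
Definition skip_tree : prog :=
  push 7 true ;;
  while 7 (discard 7 ;; pop 1 skip skip_table
    (discard 1 ;; skip_table ;; push 7 true ;; push 7 true)).

Lemma exec_skip_tree n (P : protocol n) p z o c m k g : size m = 2 ^ n ->
  exec skip_tree [:: p; Defs.code P ++ z; o; c; [::]; m; [::]; [::]; [::]; k; g]
    [:: p; z; o; c; [::]; m; [::]; [::]; [::]; k; g].
Proof.
move=> sm; have st (a : n.-tuple bool -> bool) : size (table a) = size m.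
  by rewrite size_map size_words sm.
pose loop q z' := exec (while 7 (discard 7 ;; pop 1 skip skip_table
    (discard 1 ;; skip_table ;; push 7 true ;; push 7 true)) : prog)
  [:: p; z'; o; c; [::]; m; [::]; q; [::]; k; g]
  [:: p; z; o; c; [::]; m; [::]; [::]; [::]; k; g].
(* In continuation form: one more mark pays for one more tree in front, and an inner node uses the
   hypothesis twice. *)
have H q z' : loop q z' -> loop (true :: q) (Defs.code P ++ z').
  elim: P q z' => [a|a P0 IH0 P1 IH1|a P0 IH0 P1 IH1] q z' h.
  - apply: exec_while_step h => //.
    apply: exec_seq; first exact: exec_discard.
    by apply: exec_pop => //=; apply: exec_skip_table.
  - have {}h : loop [:: true, true & q] (Defs.code P0 ++ Defs.code P1 ++ z') by apply/IH0/IH1.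
    apply: exec_while_step h => //; rewrite /= -!catA.
    apply: exec_seq; first exact: exec_discard.
    apply: exec_pop => //=.
    apply: exec_seq; first exact: exec_discard.
    by apply: exec_seq; [exact: exec_skip_table | execute].
  - have {}h : loop [:: true, true & q] (Defs.code P0 ++ Defs.code P1 ++ z') by apply/IH0/IH1.
    apply: exec_while_step h => //; rewrite /= -!catA.
    apply: exec_seq; first exact: exec_discard.
    apply: exec_pop => //=.
    apply: exec_seq; first exact: exec_discard.
    by apply: exec_seq; [exact: exec_skip_table | execute].
apply: exec_seq; first exact: exec_push.
by apply: H; apply: exec_while_stop.
Qed.

(** After the table, the code of the 0-child comes next and is skipped only on transcript bit true.
    The 1-child's code is never removed, only left behind. *)
Definition read_node (own : bool) : prog :=
  pop 0 skip (if own then restrict false else skip_table)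
    ((if own then restrict true else skip_table) ;; skip_tree).

Definition walk alice : prog :=
  push 10 true ;;
  while 10 (pop 1 skip (discard 10)
    (pop 1 skip (read_node alice) (read_node (~~ alice)))).

(** Given the protocol, the transcript is self-delimiting: the walk stops at a leaf, so [p] may
    follow without a separator. The unread code is [z]. *)
Lemma exec_walk alice n (P : protocol n) x y p o c k : exists z,
  exec (walk alice)
    [:: transcript P x y ++ p; Defs.code P; o; c; [::]; nseq (2 ^ n) true; [::]; [::]; [::]; k; [::]]
    [:: p; z; o; c; [::]; [seq fibre alice P x y w | w <- words n]; [::]; [::]; [::]; k; [::]].
Proof.
have node (B a : n.-tuple bool -> bool) (P0 P1 : protocol n) b own q z :
    exec (read_node own)
      [:: b :: q; table a ++ Defs.code P0 ++ Defs.code P1 ++ z; o; c; [::];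
        [seq B w | w <- words n]; [::]; [::]; [::]; k; [:: true]]
      [:: q; (if b then Defs.code P1 ++ z else Defs.code P0 ++ (Defs.code P1 ++ z)); o; c; [::];
        [seq B w && (own ==> (a w == b)) | w <- words n]; [::]; [::]; [::]; k; [:: true]].
  have step v z' : exec (if own then restrict v else skip_table)
      [:: q; table a ++ z'; o; c; [::]; [seq B w | w <- words n]; [::]; [::]; [::]; k; [:: true]]
      [:: q; z'; o; c; [::]; [seq B w && (own ==> (a w == v)) | w <- words n];
         [::]; [::]; [::]; k; [:: true]].
    case: own; first exact: exec_restrict.
    rewrite (eq_map (f := fun w => B w && true) (g := B)); first by apply: exec_skip_table; rewrite !size_map.
    by move=> w; rewrite /= andbT.
  apply: exec_pop => //=; case: b; last exact: step.
  apply: exec_seq; first exact: step.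
  by apply: exec_skip_tree; rewrite size_map size_words.
(* The mask [B] collects the constraints met above the current node, and [t] is the code after its
   subtree. *)
have H (B : n.-tuple bool -> bool) t : exists z,
    exec (while 10 (pop 1 skip (discard 10)
      (pop 1 skip (read_node alice) (read_node (~~ alice)))) : prog)
    [:: transcript P x y ++ p; Defs.code P ++ t; o; c; [::]; [seq B w | w <- words n];
      [::]; [::]; [::]; k; [:: true]]
    [:: p; z; o; c; [::]; [seq B w && fibre alice P x y w | w <- words n];
      [::]; [::]; [::]; k; [::]].
  elim: P B t => [a|a P0 IH0 P1 IH1|a P0 IH0 P1 IH1] B t /=.
  - exists (table a ++ t); loop; first by apply: exec_pop => //=; exact: exec_discard.
    rewrite (eq_map (f := fun w => B w && true) (g := B)); first by stop.
    by move=> w; rewrite andbT.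
  - have [z hz] : exists z,
        exec (while 10 (pop 1 skip (discard 10)
          (pop 1 skip (read_node alice) (read_node (~~ alice)))) : prog)
        [:: transcript (if a x then P1 else P0) x y ++ p;
           (if a x then Defs.code P1 ++ t else Defs.code P0 ++ (Defs.code P1 ++ t)); o; c; [::];
           [seq B w && (alice ==> (a w == a x)) | w <- words n];
           [::]; [::]; [::]; k; [:: true]]
        [:: p; z; o; c; [::]; [seq B w && ((alice ==> (a w == a x)) &&
            fibre alice (if a x then P1 else P0) x y w) | w <- words n];
           [::]; [::]; [::]; k; [::]].
      have e P' : [seq B w && ((alice ==> (a w == a x)) && fibre alice P' x y w)
          | w <- words n] =
          [seq (B w && (alice ==> (a w == a x))) && fibre alice P' x y w | w <- words n].
        by apply: eq_map => w; rewrite andbA.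
      by rewrite e; case: (a x) {e}; [apply: IH1 | apply: IH0].
    exists z; apply: exec_while_step hz => //.
    by apply: exec_pop => //=; apply: exec_pop => //=; rewrite -!catA; exact: node.
  - have [z hz] : exists z,
        exec (while 10 (pop 1 skip (discard 10)
          (pop 1 skip (read_node alice) (read_node (~~ alice)))) : prog)
        [:: transcript (if a y then P1 else P0) x y ++ p;
           (if a y then Defs.code P1 ++ t else Defs.code P0 ++ (Defs.code P1 ++ t)); o; c; [::];
           [seq B w && (~~ alice ==> (a w == a y)) | w <- words n];
           [::]; [::]; [::]; k; [:: true]]
        [:: p; z; o; c; [::]; [seq B w && ((~~ alice ==> (a w == a y)) &&
            fibre alice (if a y then P1 else P0) x y w) | w <- words n];
           [::]; [::]; [::]; k; [::]].
      have e P' : [seq B w && ((~~ alice ==> (a w == a y)) && fibre alice P' x y w)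
          | w <- words n] =
          [seq (B w && (~~ alice ==> (a w == a y))) && fibre alice P' x y w | w <- words n].
        by apply: eq_map => w; rewrite andbA.
      by rewrite e; case: (a y) {e}; [apply: IH1 | apply: IH0].
    exists z; apply: exec_while_step hz => //.
    by apply: exec_pop => //=; apply: exec_pop => //=; rewrite -!catA; exact: node.
have [z hz] := H xpredT [::]; exists z.
apply: exec_seq; first exact: exec_push.
have -> : nseq (2 ^ n) true = [seq xpredT w | w <- words n].
  by rewrite -size_words; elim: (words n) => //= w ws <-.
by move: hz; rewrite cats0.
Qed.

Definition emit : prog := move_stack 3 4 ;; while 4 (pop 4 skip (out false) (out true)).

Lemma exec_emit p z o c m m' q k g :
  exec emit [:: p; z; o; rev c; [::]; m; m'; q; [::]; k; g]
    [:: p; z; o ++ c; [::]; [::]; m; m'; q; [::]; k; g].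
Proof.
apply: exec_seq; first exact: exec_move.
rewrite /= -/(rev _) revK; elim: c o => [|b c IH] o; first by rewrite cats0; stop.
rewrite -cat_rcons; apply: exec_while_step (IH _) => //.
by apply: exec_pop => //=; case: b; exact: exec_out.
Qed.

(* Starting from the number on tape 0, counts the marked words until overflow;
   the word on which it occurs is the output. *)
Definition select : prog :=
  push 10 true ;;
  while 10 (pop 5 skip (increment 3)
    (push 9 true ;; increment 0 ;; pop 9 (discard 10 ;; emit) skip (increment 3))).

(** Each marked word increments the index once; starting from [i] it overflows at increment
    [size r + 1], which falls on [x]. *)
Lemma exec_select n L (A : pred (n.-tuple bool)) pre x post i r z :
  words n = pre ++ x :: post -> A x ->
  consecutive L (i :: r) -> count A pre = size r -> exists2 s,
  exec select
    [:: i; z; [::]; nseq n false; [::]; [seq A w | w <- words n]; [::]; [::]; [::]; [::]; [::]] s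
  & nth [::] s 2 = x.
Proof.
move=> ew Ax cr cnt.
exists [:: nseq L false; z; tval x; [::]; [::]; [seq A w | w <- post]; [::]; [::]; [::]; [::]; [::]] => //.
apply: exec_seq; first exact: exec_push.
have cw : consecutive n [seq rev w | w : n.-tuple bool <- pre ++ x :: post].
  by rewrite -ew; exact: consecutive_rwords.
(* The counter is written as the head of the words still to visit, a form stable under induction on
   [pre]. *)
have -> : nseq n false = head (nseq n false)
    [seq rev w | w : n.-tuple bool <- pre ++ x :: post].
  by rewrite -ew; have [? e] := head_rwords n; rewrite -/(rwords n) e.
rewrite {}ew /=; elim: pre i r cr cw cnt => [|w pre IH] i r cr cw cnt.
  have r0 : r = [::] by case: (r) cnt.
  move: cr; rewrite r0 => -[/= ai ii _].
  apply: exec_while_step => //; last exact: exec_while_stop.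
  apply: exec_pop => //=; rewrite Ax.
  apply: exec_seq; first exact: exec_push.
  apply: exec_seq; first exact: exec_incr0.
  rewrite ai ii /=; apply: exec_pop => //=.
  apply: exec_seq; first exact: exec_discard.
  exact: (@exec_emit _ _ [::] (tval x)).
case: cw => _ iw cw.
have {}iw : incr (rev w) =
    head (nseq n false) [seq rev w | w : n.-tuple bool <- pre ++ x :: post].
  by rewrite iw; case: (pre).
move: cnt => /=; case Aw: (A w) => /= cnt; last first.
  apply: exec_while_step (IH i r cr cw cnt) => //.
  apply: exec_pop => //=; rewrite -iw.
  have := @exec_incr3 i z [::] (rev w)
  [seq A w | w <- pre ++ x :: post] [::] [::] [::] [:: true].
  by rewrite if_same.
case: r cr cnt => [|j r] //= [ai ii cr] [cnt].
apply: exec_while_step (IH j r cr cw cnt) => //.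
apply: exec_pop => //=; rewrite -iw.
apply: exec_seq; first exact: exec_push.
apply: exec_seq; first exact: exec_incr0.
rewrite ai ii /=; apply: exec_pop => //=.
have := @exec_incr3 j z [::] (rev w)
  [seq A w | w <- pre ++ x :: post] [::] [::] [::] [:: true].
by rewrite if_same.
Qed.

Definition decode_input alice : prog :=
  zeros ;; fill true ;; move_stack 6 5 ;; walk alice ;; select.

Lemma decode_input_computes alice n (P : protocol n) x y (w : n.-tuple bool) L :
  fibre alice P x y w -> count (fibre alice P x y) (words n) <= 2 ^ L ->
  exists2 i, size i = L &
  computes (machine_of (decode_input alice)) (transcript P x y ++ i) (description P) w.
Proof.
set A := fibre _ _ _ _ => Aw cL.
have [pre [post ew]] : exists pre post, words n = pre ++ w :: post.
  by case/path.splitPr: (mem_words w) => pre post; exists pre, post.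
have lt : count A pre < size (rwords L).
  rewrite size_rwords; apply: leq_trans cL.
  by rewrite ew count_cat /= Aw; lia.
(* Starting at position [d] leaves [count A pre] words after the first, so overflow comes exactly at
   [w]. *)
pose d := (size (rwords L)).-1 - count A pre.
have cr := consecutive_rwords L.
rewrite -(cat_take_drop d (rwords L)) in cr; move/consecutive_cat in cr.
have sd := size_drop d (rwords L).
case ed: (drop d (rwords L)) cr sd => [|i r] cr /= sd; first by lia.
exists i.
  apply: size_rwords_mem; rewrite -(cat_take_drop d (rwords L)) ed mem_cat mem_head orbT //.
have [z hz] := exec_walk alice P x y i [::] (nseq n false) [::].
have [|s hs sx] := @exec_select n L A pre w post i r z ew Aw cr.
  by rewrite /d in sd; lia.
rewrite -sx.
have {}hs : exec (decode_input alice)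
    [:: transcript P x y ++ i; description P; [::]; [::]; [::]; [::]; [::]; [::]; [::]; [::]; [::]] s.
  apply: exec_seq; first exact: (@exec_zeros n _ (Some (Defs.code P))).
  apply: exec_seq; first exact: exec_fill.
  apply: exec_seq; first exact: exec_move.
  rewrite /= cats0 -/(rev _) rev_nseq.
  by apply: exec_seq; first exact: hz.
apply: machine_of_computes => T hT; apply: hs => t; have := hT t.
by move: t => [[|[|[|[|[|[|[|[|[|[|[|t]]]]]]]]]]] ht] //=; rewrite nth_nil.
Qed.

(** * The lower bound *)

Lemma complexity_le U p z x : computes U p z x -> complexity U x z <= size p.
Proof.
move=> hp; have px : has_program U x z (size p) by apply/asboolP; exists p.
rewrite /complexity; case: pselect => // h.
by case: ex_minnP => m _; apply.
Qed.

Lemma small_fibre U w n f (P : protocol n) x y (K := size w + 8) :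
  (forall p z v, computes U (w ++ p) z v <-> computes (machine_of decode_table) p z v) ->
  0 < n -> 2 ^ (2 * n) <= complexity U (truth_table f) (unary n) + n -> solves P f ->
  count (fibre true P x y) (words n) <= K * n \/ count (fibre false P x y) (words n) <= K * n.
Proof.
move=> hw n0 hC hP.
have [le|lA] := leqP (count (fibre true P x y) (words n)) (K * n); first by left.
have [le|lB] := leqP (count (fibre false P x y) (words n)) (K * n); first by right.
exfalso.
(* With exactly [K * n] elements on each side, the saving is quadratic in [K * n] and the naming
   cost linear in it. *)
pose F b := take (K * n) [seq u <- words n | fibre b P x y u].
have sF b : K * n < count (fibre b P x y) (words n) -> size (F b) = K * n.
  by move=> lt; rewrite size_takel // size_filter ltnW.
have uF b : uniq (F b) by rewrite take_uniq // filter_uniq // uniq_words.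
have mF b u : u \in F b -> fibre b P x y u by move/mem_take; rewrite mem_filter => /andP[].
have fl u v : u \in F true -> v \in F false -> f u v = leaf P x y u.
  by move=> /mF fu /mF fv; rewrite -hP; apply: run_leaf.
have := complexity_le ((hw _ _ _).2 (decode_table_computes fl)).
have := size_table_code (leaf P x y) f (uF true) (uF false).
rewrite size_cat !sF // => e le.
have : 2 ^ (2 * n) <= size w + size (table_code (F true) (F false) (leaf P x y) f) + n by lia.
set s := K * n in e *; move: (table_code _ _ _ _) e => t e.
(* The code would force [s * s <= s * (2 * n + 3) + size w + 2 + n]. The constant 8 in [K] gives
   this bound on [s], hence a slack of [s * (size w + 3)], which exceeds [size w + 2 + n]. *)
have h1 : (2 * n + 3) + (size w + 3) <= s.
  rewrite /s /K -[8](addnA 6 2) addnA mulnDl; have := leq_pmulr (size w + 6) n0; lia.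
have h2 := leq_mul (leqnn s) h1.
have h3 : size w + 2 <= s * (size w + 2) by rewrite leq_pmull //; lia.
rewrite !mulnDr !(mulnS _ n) in e h2 h3 *; lia.
Qed.

Local Open Scope ring_scope.

Lemma trunc_log_le_log2 (R : realType) n : (0 < n)%N -> (trunc_log 2 n)%:R <= log2 n%:R :> R.
Proof.
move=> n0; have l2 : 0 < ln 2 :> R by rewrite ln_gt0 // ltr1n.
rewrite /log2 ler_pdivlMr // mulr_natl -lnXn // ler_ln ?posrE ?exprn_gt0 ?ltr0n //.
by rewrite -natrX ler_nat trunc_logP.
Qed.

Theorem theorem2 (R : realType) (U : machine) (hU : universal U) :
  exists c : R, forall (n : nat) (f : n.-tuple bool -> n.-tuple bool -> bool),
    (1 <= n)%N ->
    2 ^+ (2 * n) - n%:R <= (complexity U (truth_table f) (unary n))%:R :> R ->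
    forall P : protocol n, solves P f ->
    forall x y : n.-tuple bool,
      (cost P x y)%:R >=
      Num.min (complexity U x (description P))%:R
              (complexity U y (description P))%:R - log2 n%:R - c.
Proof.
have [w hw] := hU (machine_of decode_table).
have [wA hwA] := hU (machine_of (decode_input true)).
have [wB hwB] := hU (machine_of (decode_input false)).
pose K := (size w + 8)%N.
(* Both prefixes are counted so that one constant serves either side; [K + 1] is the excess of the
   index length over [trunc_log 2 n]. *)
exists (size wA + size wB + K + 1)%:R => n f n0 hC P hP x y.
rewrite lerBlDr -natrX -natrD ler_nat in hC.
(* Spending [K] bits on the factor [K] is wasteful but costs only a constant. *)
pose L := (K + (trunc_log 2 n).+1)%N.
have KL : (K * n <= 2 ^ L)%N.
  rewrite expnD leq_mul //; first by rewrite ltnW // ltn_expl.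
  by rewrite ltnW // trunc_log_ltn.
have bound v alice (v' : n.-tuple bool) :
    (forall p z u, computes U (v ++ p) z u <-> computes (machine_of (decode_input alice)) p z u) ->
    fibre alice P x y v' -> (count (fibre alice P x y) (words n) <= K * n)%N ->
    (size v <= size wA + size wB)%N ->
    (complexity U v' (description P))%:R - log2 n%:R - (size wA + size wB + K + 1)%:R
      <= (cost P x y)%:R :> R.
  move=> hv fv le sv.
  have [i si hi] := decode_input_computes fv (leq_trans le KL).
  have := complexity_le ((hv _ _ _).2 hi).
  rewrite !size_cat size_transcript si => hle.
  have : (complexity U v' (description P) <=
    size wA + size wB + K + 1 + cost P x y + trunc_log 2 n)%N by rewrite /L in hle; lia.
  rewrite -(ler_nat R) 2!natrD; have := trunc_log_le_log2 R n0; lra.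
have [le|le] := small_fibre x y hw n0 hC hP.
- apply: le_trans (bound _ _ _ hwA (fibre_alice P x y) le (leq_addr _ _)).
  by rewrite !lerD2r ge_min lexx.
- apply: le_trans (bound _ _ _ hwB (fibre_bob P x y) le (leq_addl _ _)).
  by rewrite !lerD2r ge_min lexx orbT.
Qed.
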